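(* Let $\Phi$ be an integrator for Hamiltonian systems in $\mathbb{R}^2$. Let $H(q,p)=p^2/2$ on $\mathbb{R}^2$, and let $U\subset\mathbb{R}^2$ be an open neighbourhood of $\{(q,1)\mid q\in\mathbb{R}\}$. Suppose: (1) $\Phi$ is consistent at $(0,1)$ for the Hamiltonian $H$; (2) $\Phi$ is computationally reasonable; (3) $\Phi$ conserves energy for any Hamiltonian, any point $(q,p)$, and any $\Delta t$ for which it is defined; (4) there is $\Delta t_0>0$ such that for $\Delta t\le \Delta t_0$, $\Phi(H,(q,p),\Delta t)$ is defined for all $(q,p)\in U$, depends continuously on $(q,p)\in U$, and conserves volume on $U$. Then for all sufficiently small $\Delta t>0$ there is a $C_0^\infty$ function $V:\mathbb{R}\to\mathbb{R}$ such that, if $\widetilde H(q,p)=p^2/2+V(q)$, then $\Phi(\widetilde H,\cdot,\Delta t)$ is not simultaneously defined, continuous, and volume-conserving on $U$. Moreover, for each such $\Delta t$, $V$ can be chosen so that the same conclusion holds with $V$ replaced by $\lambda V$ for every $\lambda\in(0,1)$.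
   Context: Phase space is $\mathbb{R}^{2n}$ (here $n=1$) with coordinates $(q,p)$, $q,p\in\mathbb{R}^n$. The Hamiltonian system of $H:\mathbb{R}^{2n}\to\mathbb{R}$ is $dq/dt=\partial H/\partial p$, $dp/dt=-\partial H/\partial q$; its time-$t$ flow map is denoted $S^t$. Integrator: a function $\Phi$ that takes as arguments a Hamiltonian $H:\mathbb{R}^{2n}\to\mathbb{R}$, a point $(q,p)\in\mathbb{R}^{2n}$ and a step $\Delta t\in[0,\infty)$, and either returns a point $\Phi(H,(q,p),\Delta t)\in\mathbb{R}^{2n}$ or is not defined (so it is a partial function). For a multi-index $\alpha\in\mathbb{N}_0^{2n}$, $\partial_\alpha H=\frac{\partial^{\alpha_1}}{\partial q_1^{\alpha_1}}\cdots\frac{\partial^{\alpha_n}}{\partial q_n^{\alpha_n}}\frac{\partial^{\alpha_{n+1}}}{\partial p_1^{\alpha_{n+1}}}\cdots\frac{\partial^{\alpha_{2n}}}{\partial p_n^{\alpha_{2n}}}H$. Computationally reasonable: $\Phi$ is computationally reasonable if for each $H:\mathbb{R}^{2n}\to\mathbb{R}$, $(q,p)\in\mathbb{R}^{2n}$ and $\Delta t\ge 0$ there exist $m\in\mathbb{N}_0$, points $(r^j,s^j)\in\mathbb{R}^{2n}$ and multi-indices $\alpha^j\in\mathbb{N}_0^{2n}$, $j=1,\dots,m$, such that for any $\widetilde H:\mathbb{R}^{2n}\to\mathbb{R}$ with $\partial_{\alpha^j}\widetilde H(r^j,s^j)=\partial_{\alpha^j}H(r^j,s^j)$ for $j=1,\dots,m$,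 either $\Phi(H,(q,p),\Delta t)=\Phi(\widetilde H,(q,p),\Delta t)$ or both are not defined. (Hamiltonians are understood to be smooth, so that these derivatives exist.) Consistent: $\Phi$ is consistent at $(q,p)$ for the Hamiltonian $H$ with flow $S^t$ if $\lim_{\Delta t\to 0}\|S^{\Delta t}(q,p)-\Phi(H,(q,p),\Delta t)\|/\Delta t=0$ (limit over $\Delta t>0$). Energy conservation: $H(\Phi(H,(q,p),\Delta t))=H(q,p)$. Volume conservation of a map $\Psi$ on $U$: $\mathrm{vol}(\Psi(A))=\mathrm{vol}(A)$ for all bounded open $A\subset U$ (volume is area when $n=1$). $C_0^\infty$ means smooth with compact support. *)

(* Defs.v *)
From HB Require Import structures.
From mathcomp Require Import all_boot all_order all_algebra.
From mathcomp Require Import all_classical all_reals all_analysis.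

Set Implicit Arguments.
Unset Strict Implicit.
Unset Printing Implicit Defensive.

Import Order.TTheory GRing.Theory Num.Theory.
Import numFieldNormedType.Exports.

Local Open Scope classical_set_scope.
Local Open Scope ring_scope.

(* One degree of freedom: a point (q, p) of phase space is a pair, q first. *)

Definition partial_q (R : realType) (H : R * R -> R) (z : R * R) : R :=
  'D_(1, 0) H z.

Definition partial_p (R : realType) (H : R * R -> R) (z : R * R) : R :=
  'D_(0, 1) H z.

Definition partial (R : realType) (a : nat * nat) (H : R * R -> R) :
    R * R -> R :=
  iter a.1 (@partial_q R) (iter a.2 (@partial_p R) H).

Fixpoint Ck (R : realType) (k : nat) (H : R * R -> R) : Prop :=
  if k is j.+1 then
    [/\ continuous H,
        forall z, derivable H z (1, 0),
        forall z, derivable H z (0, 1),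
        Ck j (partial_q H)
      & Ck j (partial_p H)]
  else continuous H.

Definition smooth2 (R : realType) (H : R * R -> R) : Prop :=
  forall k, Ck k H.

Definition smooth_compact_support (R : realType) (V : R -> R) : Prop :=
  (forall (k : nat) (x : R), derivable (derive1n k V) x 1) /\
  compact (closure [set x | V x != 0]).

(* Complete flow of dq/dt = dH/dp, dp/dt = - dH/dq. *)
Definition is_flow (R : realType) (H : R * R -> R) (S : R -> R * R -> R * R) :
    Prop :=
  forall z, S 0 z = z /\
    forall t : R,
      is_derive t (1 : R) (fun s => (S s z).1) (partial_p H (S t z)) /\
      is_derive t (1 : R) (fun s => (S s z).2) (- partial_q H (S t z)).

(* [None] means undefined.  The values at non-smooth [H] or at a negative step
   are never constrained nor used: every condition below only involves smooth
   Hamiltonians and steps [0 <= dt]. *)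
Definition integrator (R : realType) : Type :=
  (R * R -> R) -> R * R -> R -> option (R * R).

Definition computationally_reasonable (R : realType) (Phi : integrator R) :
    Prop :=
  forall (H : R * R -> R) (z : R * R) (dt : R), smooth2 H -> 0 <= dt ->
  exists (m : nat) (r : 'I_m -> R * R) (a : 'I_m -> nat * nat),
    forall H' : R * R -> R, smooth2 H' ->
      (forall j, partial (a j) H' (r j) = partial (a j) H (r j)) ->
      Phi H z dt = Phi H' z dt.

(* The norm of [R * R] is the sup norm, equivalent to the Euclidean one. *)
Definition consistent_at (R : realType) (Phi : integrator R)
    (H : R * R -> R) (S : R -> R * R -> R * R) (z : R * R) : Prop :=
  exists f : R -> R * R,
    (\forall dt \near 0^'+, Phi H z dt = Some (f dt)) /\
    `|S dt z - f dt| / dt @[dt --> 0^'+] --> (0 : R).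

Definition conserves_energy (R : realType) (Phi : integrator R) : Prop :=
  forall (H : R * R -> R) (z w : R * R) (dt : R), smooth2 H -> 0 <= dt ->
    Phi H z dt = Some w -> H w = H z.

(* Genuine area on Borel sets; the product measure takes unspecified values on
   other sets.  The images measured below are images of open sets under
   continuous maps, hence sigma-compact. *)
Definition area (R : realType) (A : set (R * R)) : \bar R :=
  (@lebesgue_measure R \x @lebesgue_measure R)%E A.

Definition conserves_volume (R : realType) (U : set (R * R))
    (f : R * R -> R * R) : Prop :=
  forall A : set (R * R), open A -> bounded_set A -> A `<=` U ->
    area (f @` A) = area A.

(* The partial map [Psi] is defined on [U] (where it coincides with [f]),
   continuous on [U] and volume-conserving on [U].  As [f] is determined on [U]
   by [Psi], the existential is only a device to speak of the values. *)
Definition continuous_conservative_on (R : realType) (U : set (R * R))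
    (Psi : R * R -> option (R * R)) : Prop :=
  exists f : R * R -> R * R,
    [/\ forall z, U z -> Psi z = Some (f z),
        {within U, continuous f}
      & conserves_volume U f].

Definition natural_hamiltonian (R : realType) (V : R -> R) (z : R * R) : R :=
  z.2 ^+ 2 / 2 + V z.1.

Definition free_hamiltonian (R : realType) (z : R * R) : R := z.2 ^+ 2 / 2.

(* Main.v *)
(* For the free Hamiltonian, energy conservation makes the map near (0, 1) of
   the form (q, p) |-> (g(q, p), p), and area conservation on thin rectangles
   around p = 1 shows that g(., 1) cannot shorten intervals: any small interval
   contains two points l < h with |g(l) - g(h)| >= h - l.  By consistency
   g(0, 1) > 0, so the interval J between g(l) and g(h) lies to the right of
   [l, h].  Take for V a small bump supported inside J, away from the finitely
   many abscissas on which the values of the integrator at (l, 1) and (h, 1)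
   depend.  These two values are then unchanged, so by the intermediate value
   theorem the thin rectangle |p - 1| < ep above [l, h] is mapped onto (at
   least) the part of the energy strip ((1 - ep)^2 < p^2 + 2 V < (1 + ep)^2)
   above J.  Where V > 0 that strip is thicker than 2 ep, by a factor bounded
   away from 1 as ep -> 0 (equivalently, the motion is slower there), so the
   image has too large an area. *)
Require Import Defs.
From mathcomp Require Import all_boot all_order all_algebra.
From mathcomp Require Import all_classical all_reals all_analysis.
From mathcomp Require Import measurable_realfun ring lra.
Import Order.TTheory GRing.Theory Num.Theory.
Import numFieldNormedType.Exports.
Local Open Scope classical_set_scope.
Local Open Scope ring_scope.

(** * Smooth bump functions *)

Section FlatFunctions.
Context {R : realType}.
Implicit Types (P : {poly R}) (x : R).

(** The polynomial factor in 1/x makes the family stable under differentiation, so smoothness at 0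
    included follows from a single derivative formula. *)
Definition flat P x : R := if 0 < x then P.[x^-1] * expR (- x^-1) else 0.

Lemma flat_pos P x : 0 < x -> flat P x = P.[x^-1] * expR (- x^-1).
Proof. by rewrite /flat => ->. Qed.

Lemma flat_npos P x : x <= 0 -> flat P x = 0.
Proof. by rewrite /flat ltNge => ->. Qed.

(* The series of exp bounds x^-i exp(-x^-1) by (i + 1)! x. *)
Lemma flat_linear_bound P :
  exists2 C, 0 <= C & forall x, `|flat P x| <= C * `|x|.
Proof.
exists (\sum_(i < size P) `|P`_i| * (i.+1)`!%:R); first by apply: sumr_ge0.
move=> x; have [x0|x0] := ltP 0 x; last first.
  by rewrite flat_npos// normr0 mulr_ge0// sumr_ge0.
rewrite flat_pos// (gtr0_norm x0) horner_coef !mulr_suml.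
apply: le_trans (ler_norm_sum _ _ _) _; apply: ler_sum => i _.
rewrite !normrM -!mulrA ler_wpM2l// normrX (gtr0_norm (expR_gt0 _)).
rewrite normfV (gtr0_norm x0) expRN ler_pdivrMr ?expR_gt0//.
have xV0 : 0 <= x^-1 by rewrite invr_ge0 ltW.
have h0 : x^-1 ^+ i.+1 / i.+1`!%:R <= expR x^-1.
  by apply: le_trans (expR_ge1Dxn i xV0); rewrite lerDr.
move: h0; rewrite ler_pdivrMr ?ltr0n ?fact_gt0// exprS => h.
have := ler_wpM2l (ltW x0) h; rewrite mulrA mulfV ?gt_eqF// mul1r.
by move=> /le_trans; apply; rewrite mulrA mulrC mulrA.
Qed.

(** Chain rule: P(1/x) exp(-1/x) has derivative x^-2 (P - P')(1/x) exp(-1/x), and x^-2 is absorbed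
    as the factor ['X^2]. *)
Definition dflat P : {poly R} := 'X^2 * (P - P^`()).

Lemma is_derive_flat P x : is_derive x 1 (flat P) (flat (dflat P) x).
Proof.
have [x0|x0|<-] := ltgtP 0 x.
- apply: (@near_eq_is_derive _ _ _ (fun x => P.[x^-1] * expR (- x^-1))).
    near=> y; rewrite flat_pos//; near: y; exact: lt_nbhsr.
  have x_neq0 : x != 0 by rewrite gt_eqF.
  have dV : is_derive x 1 (fun y : R => y^-1) (- x ^- 2).
    by have := @is_deriveV _ id _ 1 1 x_neq0 _; rewrite [_ *: _]mulr1; apply.
  have dP : is_derive x 1 (fun y => P.[y^-1]) (- x ^- 2 * P^`().[x^-1]).
    have := is_derive1_comp (is_derive_poly P x^-1) dV.
    by rewrite mulrC.
  have dE : is_derive x 1 (fun y => expR (- y^-1)) (expR (- x^-1) * - - x ^- 2).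
    exact: (is_derive1_comp (is_derive_expR _) (is_deriveN dV)).
  apply: (@is_derive_eq _ _ _ _ _ _ _ _ (is_deriveM dP dE)).
  rewrite flat_pos// /dflat !hornerE /GRing.scale/=; field.
  by [].
- apply: (@near_eq_is_derive _ _ _ (cst 0)).
    near=> y; rewrite flat_npos//; apply/ltW; near: y; exact: lt_nbhsl.
  by rewrite flat_npos ?(ltW x0)//; exact: is_derive_cst.
- rewrite flat_npos//.
  have [C C0 HC] := flat_linear_bound ('X * P).
  (* The difference quotient at 0 is again a flat function. *)
  have cv : h^-1 *: (flat P (h *: 1 + 0) - flat P 0) @[h --> 0^'] --> (0 : R).
    have e h : h^-1 *: (flat P (h *: 1 + 0) - flat P 0) = flat ('X * P) h.
      rewrite addr0 (flat_npos _ _ (lexx 0)) subr0 [h *: 1]mulr1 /GRing.scale/=.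
      have [h0|h0] := ltP 0 h; last by rewrite !flat_npos// mulr0.
      by rewrite !flat_pos// hornerM hornerX mulrA.
    under eq_fun do rewrite e.
    apply/cvgr0Pnorm_lt => _/posnumP[e0]; near=> h.
    apply: le_lt_trans (HC h) _.
    (* [C] may be 0, whereas [C + 1] can be divided by. *)
    apply: (@le_lt_trans _ _ ((C + 1) * `|h|)); first by rewrite ler_wpM2r// lerDl.
    rewrite -ltr_pdivlMl ?ltr_wpDl//.
    near: h; apply: dnbhs0_lt; by rewrite mulr_gt0// invr_gt0 ltr_wpDl.
  by apply: (DeriveDef (cvgP _ cv)); apply: cvg_lim cv.
Unshelve. all: by end_near. Qed.
End FlatFunctions.

(** * Compactly supported bumps *)

Section Bump.
Context {R : realType}.
Implicit Types (f g W : R -> R) (a b s x : R).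

Definition smooth1 f := forall (k : nat) x, derivable (derive1n k f) x 1.

Lemma smooth1_closed_class (C : (R -> R) -> Prop) :
  (forall f, C f -> exists2 g, C g & forall x, is_derive x 1 f (g x)) ->
  forall f, C f -> smooth1 f.
Proof.
move=> HC f Cf k.
have : C (derive1n k f).
  elim: k => [//|k IH]; rewrite derive1nS.
  have [g Cg dg] := HC _ IH.
  suff -> : derive1 (derive1n k f) = g by [].
  by apply/funext => x; rewrite derive1E derive_val.
by case/HC => g _ dg x; have [] := dg x.
Qed.

(** Sums are there because the Leibniz rule produces them; this makes the class closed under
    differentiation. *)
Inductive flat_algebra a b : (R -> R) -> Prop :=
| FlatLeft P : flat_algebra a b (fun x => flat P (x - a))
| FlatRight P : flat_algebra a b (fun x => flat P (b - x))
| FlatAdd f g of flat_algebra a b f & flat_algebra a b g : flat_algebra a b (f \+ g)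
| FlatMul f g of flat_algebra a b f & flat_algebra a b g : flat_algebra a b (f \* g).

Lemma flat_algebra_derive a b f : flat_algebra a b f ->
  exists2 g, flat_algebra a b g & forall x, is_derive x 1 f (g x).
Proof.
elim=> {f} [P|P|f g Af [f' Af' df] Ag [g' Ag' dg]|f g Af [f' Af' df] Ag [g' Ag' dg]].
- exists (fun x => flat (dflat P) (x - a)); first exact: FlatLeft.
  move=> x; have dl : is_derive x 1 (fun y => y - a) 1.
    by have := is_deriveB (is_derive_id x (1:R)) (is_derive_cst a x 1); rewrite subr0.
  by have := is_derive1_comp (is_derive_flat P _) dl; rewrite mulr1.
- exists (fun x => flat (- dflat P) (b - x)); first exact: FlatRight.
  move=> x; have dl : is_derive x 1 (fun y => b - y) (-1).
    by have := is_deriveB (is_derive_cst b x 1) (is_derive_id x (1:R)); rewrite sub0r.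
  have := is_derive1_comp (is_derive_flat P _) dl; rewrite mulrN1.
  by rewrite /flat; case: ifPn => _; rewrite ?oppr0// hornerN mulNr.
- by exists (f' \+ g'); [exact: FlatAdd|move=> x; exact: is_deriveD].
- exists (f \* g' \+ g \* f'); last by move=> x; exact: is_deriveM.
  by apply: FlatAdd; apply: FlatMul.
Qed.

(** The amplitude enters as a constant polynomial, so [flat_algebra] contains the bump without a
    constructor for scaling. *)
Definition flat_bump s a b x : R := flat s%:P (x - a) * flat 1 (b - x).

Lemma flat_bump_smooth1 s a b : smooth1 (flat_bump s a b).
Proof.
apply: (@smooth1_closed_class (flat_algebra a b)); first exact: flat_algebra_derive.
exact: (FlatMul a b _ _ (FlatLeft a b s%:P) (FlatRight a b 1)).
Qed.

Lemma flatC s x : flat s%:P x = s * flat 1 x.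
Proof. by rewrite /flat; case: ifPn => _; rewrite ?mulr0// !hornerC mul1r. Qed.

Lemma flat1_ge0 x : 0 <= flat 1 x.
Proof. by rewrite /flat; case: ifPn => _//; rewrite hornerC mul1r expR_ge0. Qed.

Lemma flat1_gt0 x : 0 < x -> 0 < flat 1 x.
Proof. by move=> x0; rewrite flat_pos// hornerC mul1r expR_gt0. Qed.

Lemma flat1_le1 x : flat 1 x <= 1.
Proof.
rewrite /flat; case: ifPn => // x0.
by rewrite hornerC mul1r -expR0 ler_expR oppr_le0 invr_ge0 ltW.
Qed.

Lemma flat1_mono x y : x <= y -> flat 1 x <= flat 1 y.
Proof.
move=> xy; have [x0|x0] := ltP 0 x; last by rewrite flat_npos ?flat1_ge0.
have y0 := lt_le_trans x0 xy.
by rewrite !flat_pos// !hornerC !mul1r ler_expR lerN2 lef_pV2.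
Qed.

Lemma flat_bump_out s a b x : ~~ (a < x < b) -> flat_bump s a b x = 0.
Proof.
rewrite negb_and -!leNgt /flat_bump => /orP[ax|bx].
- by rewrite flat_npos ?mul0r// subr_le0.
- by rewrite [X in _ * X]flat_npos ?mulr0// subr_le0.
Qed.

Lemma flat_bump_ge0 s a b x : 0 <= s -> 0 <= flat_bump s a b x.
Proof. by move=> s0; rewrite /flat_bump flatC !mulr_ge0 ?flat1_ge0. Qed.

Lemma flat_bump_le s a b x : 0 <= s -> flat_bump s a b x <= s.
Proof.
move=> s0; rewrite /flat_bump flatC -mulrA ler_piMr//.
by rewrite mulr_ile1 ?flat1_ge0//; exact: flat1_le1.
Qed.

(** Each factor is monotone, hence bounded below by its value at the inner end point nearer to its
    zero set. *)
Lemma flat_bump_lower_bound s a b (j1 j2 : R) : 0 < s -> a < j1 -> j2 < b ->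
  exists2 v, 0 < v & forall x, j1 < x < j2 -> v <= flat_bump s a b x.
Proof.
move=> s0 aj jb; exists (s * (flat 1 (j1 - a) * flat 1 (b - j2))).
  by rewrite !mulr_gt0// flat1_gt0// subr_gt0.
move=> x /andP[jx xj]; rewrite /flat_bump flatC -mulrA ler_wpM2l ?(ltW s0)//.
by apply: ler_pM; rewrite ?flat1_ge0//; apply: flat1_mono;
  rewrite ?lerD2r ?lerD2l ?lerN2 ltW.
Qed.

Lemma flat_bumpZ l s a b : (fun x => l * flat_bump s a b x) = flat_bump (l * s) a b.
Proof. by apply/funext => x; rewrite /flat_bump (flatC s) (flatC (l * s)) !mulrA. Qed.

Lemma flat_bump_smooth_compact_support s a b : smooth_compact_support (flat_bump s a b).
Proof.
split; first exact: flat_bump_smooth1.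
apply: (@subclosed_compact _ _ `[a, b]); [exact: closed_closure|exact: segment_compact|].
rewrite -[X in _ `<=` X](_ : closure `[a, b]%classic = _); last first.
  by apply/esym/closure_id/interval_closed.
apply: closure_subset => x /= Vx; rewrite in_itv/=; apply: contraNT Vx => nx.
rewrite flat_bump_out//; apply: contra nx => /andP[ax xb].
by rewrite !ltW.
Qed.

End Bump.

(** * Smooth Hamiltonians *)

Section Hamiltonians.
Context {R : realType}.
Implicit Types (H G : R * R -> R) (W V : R -> R) (z : R * R).

Lemma is_derive_q H z d :
  is_derive z.1 1 (fun x => H (x, z.2)) d -> is_derive z (1, 0) H d.
Proof.
case=> dH <-; rewrite /derivable /derive in dH *.
set u := (X in cvg (X @ _)) in dH.
have e : u = (fun h => h^-1 *: ((H \o shift z) (h *: (1, 0)) - H z)).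
  apply/funext => h; rewrite /u /=; congr (_ *: (_ - _)); last by case: (z).
  by congr H; case: (z) => z1 z2; congr pair; rewrite /= scaler0 add0r.
by apply: DeriveDef; rewrite /derivable /derive -?e.
Qed.

Lemma is_derive_p H z d :
  is_derive z.2 1 (fun y => H (z.1, y)) d -> is_derive z (0, 1) H d.
Proof.
case=> dH <-; rewrite /derivable /derive in dH *.
set u := (X in cvg (X @ _)) in dH.
have e : u = (fun h => h^-1 *: ((H \o shift z) (h *: (0, 1)) - H z)).
  apply/funext => h; rewrite /u /=; congr (_ *: (_ - _)); last by case: (z).
  by congr H; case: (z) => z1 z2; congr pair; rewrite /= scaler0 add0r.
by apply: DeriveDef; rewrite /derivable /derive -?e.
Qed.

(** A family closed under both partial derivatives that contains the natural Hamiltonians (a = 1/2,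
    b = 0); smoothness then follows by induction on the order. *)
Definition separable (a b : R) W z := a * z.2 ^+ 2 + b * z.2 + W z.1.

Lemma separable_q a b W z : smooth1 W ->
  is_derive z (1, 0) (separable a b W) (separable 0 0 (derive1 W) z).
Proof.
move=> sW; apply: is_derive_q; rewrite /separable /= !mul0r !add0r derive1E.
have dW : is_derive z.1 1 W ('D_1 W z.1) by split=> //; exact: (sW 0%N).
by have := is_deriveD (is_derive_cst (a * z.2 ^+ 2 + b * z.2) z.1 1) dW; rewrite add0r.
Qed.

Lemma separable_p a b W z :
  is_derive z (0, 1) (separable a b W) (separable 0 (2 * a) (cst b) z).
Proof.
apply: is_derive_p; rewrite /separable /=.
apply: is_derive_eq; rewrite /GRing.scale/=; ring.
Qed.

Lemma smooth1_continuous W : smooth1 W -> continuous W.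
Proof.
by move=> sW x; apply/differentiable_continuous/derivable1_diffP/(sW 0%N).
Qed.

Lemma separable_continuous a b W : smooth1 W -> continuous (separable a b W).
Proof.
move=> sW z; rewrite /separable.
apply: cvgD; last by apply: continuous_comp; [exact: cvg_fst|exact: smooth1_continuous].
apply: cvgD; apply: cvgM; try exact: cvg_cst; try exact: cvg_snd.
by apply: (continuous_comp (f := snd) (g := fun y : R => y ^+ 2));
  [exact: cvg_snd|exact: exprn_continuous].
Qed.

Lemma smooth1_derive W : smooth1 W -> smooth1 (derive1 W).
Proof. by move=> sW k x; have := sW k.+1 x; rewrite /derive1n iterSr. Qed.

Lemma smooth1_cst (c : R) : smooth1 (cst c).
Proof.
apply: (@smooth1_closed_class _ (fun f => exists c, f = cst c)); last by exists c.
by move=> _ [d ->]; exists (cst 0); [exists 0|move=> x; exact: is_derive_cst].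
Qed.

Lemma separable_smooth2 a b W : smooth1 W -> smooth2 (separable a b W).
Proof.
move=> sW k; elim: k a b W sW => [|k IH] a b W sW /=.
  exact: separable_continuous.
split.
- exact: separable_continuous.
- by move=> z; have [] := separable_q a b W z sW.
- by move=> z; have [] := separable_p a b W z.
- rewrite (_ : partial_q _ = separable 0 0 (derive1 W)); first by apply/IH/smooth1_derive.
  by apply/funext => z; have [_] := separable_q a b W z sW.
- rewrite (_ : partial_p _ = separable 0 (2 * a) (cst b)); first by apply/IH/smooth1_cst.
  by apply/funext => z; have [_] := separable_p a b W z.
Qed.

Lemma natural_smooth2 V : smooth1 V -> smooth2 (natural_hamiltonian V).
Proof.
move=> sV; rewrite (_ : natural_hamiltonian V = separable 2^-1 0 V).
  exact: separable_smooth2.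
by apply/funext => z; rewrite /natural_hamiltonian /separable mul0r addr0 mulrC.
Qed.

Lemma free_smooth2 : smooth2 (@free_hamiltonian R).
Proof.
rewrite (_ : @free_hamiltonian R = natural_hamiltonian (cst 0)).
  exact/natural_smooth2/smooth1_cst.
by apply/funext => z; rewrite /natural_hamiltonian addr0.
Qed.

(** Agreement above an open set of abscissas passes to each directional derivative, so it survives
    iteration. It is applied off an interval that contains the support of the potential. *)
Lemma partial_local (O : set R) (a : nat * nat) G H : open O ->
  (forall z, O z.1 -> G z = H z) -> forall z, O z.1 -> partial a G z = partial a H z.
Proof.
move=> oO.
have step v F K : (forall z, O z.1 -> F z = K z) ->
    forall z : R * R, O z.1 -> 'D_v F z = 'D_v K z.
  move=> FK z Oz; apply: near_eq_derive.
  have : \forall w \near z, O w.1 by apply: cvg_fst; exact: open_nbhs_nbhs.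
  by apply: filterS => w; exact: FK.
move=> GH; rewrite /partial.
have {GH} : forall z, O z.1 -> iter a.2 (@partial_p R) G z = iter a.2 (@partial_p R) H z.
  by elim: a.2 => [//|n IH] z Oz /=; exact: step.
by elim: a.1 => [//|n IH] Hp z Oz /=; apply: step => // *; exact: IH.
Qed.

End Hamiltonians.

(** * Area *)

Section Area.
Context {R : realType}.
Implicit Types (A B X : set (R * R)).
Notation mu := (@lebesgue_measure R).

(* No measurability is needed: the integral of a nonnegative function is the
   supremum of the integrals of the simple functions below it. *)
Lemma ge0_le_integral_nomeas d (T : measurableType d) (m : {measure set T -> \bar R})
    (f g : T -> \bar R) :
  (forall x, 0 <= f x)%E -> (forall x, f x <= g x)%E ->
  (\int[m]_x f x <= \int[m]_x g x)%E.
Proof.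
move=> f0 fg; rewrite !ge0_integralTE//; last first.
  by move=> x; exact: le_trans (f0 x) (fg x).
apply: le_ereal_sup => _ [h hf <-]; exists h => // x.
exact: le_trans (hf x) (fg x).
Qed.

(* [lebesgue_measure] is, on all sets, the underlying outer measure. *)
Lemma le_lebesgue_measure_nomeas (A B : set R) : A `<=` B -> (mu A <= mu B)%E.
Proof. by move=> AB; exact: (le_outer_measure (mu_ext _)). Qed.

Lemma lebesgue_measure_oo (a b : R) : a < b -> mu `]a, b[ = (b - a)%:E.
Proof. by move=> ab; rewrite lebesgue_measure_itv/= lte_fin ab. Qed.

Lemma le_area A B : A `<=` B -> (area A <= area B)%E.
Proof.
move=> AB; apply: ge0_le_integral_nomeas => [x|x] /=; first exact: measure_ge0.
by apply: le_lebesgue_measure_nomeas => y; rewrite /xsection/= !inE; exact: AB.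
Qed.

Lemma area_rect (a b c d : R) : a <= b -> c <= d ->
  area (`]a, b[ `*` `]c, d[) = ((b - a) * (d - c))%:E.
Proof.
move=> ab cd; rewrite /area product_measure1E//=.
rewrite !lebesgue_measure_itv/= !lte_fin.
move: ab; rewrite le_eqVlt => /predU1P[->|ab]; first by rewrite ltxx mul0e subrr mul0r.
move: cd; rewrite le_eqVlt => /predU1P[->|cd]; first by rewrite ltxx mule0 subrr mulr0.
by rewrite ab cd -!EFinD -EFinM.
Qed.

(** The section lengths dominate a step function, equal to al on ]j1, j2[ plus be on ]k1, k2[, whose
    integral is explicit. *)
Lemma area_ge X (j1 j2 k1 k2 al be : R) : j1 <= k1 -> k1 < k2 -> k2 <= j2 ->
  0 <= al -> 0 <= be ->
  (forall q, j1 < q < j2 -> (al%:E <= mu (xsection X q))%E) ->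
  (forall q, k1 < q < k2 -> ((al + be)%:E <= mu (xsection X q))%E) ->
  ((al * (j2 - j1) + be * (k2 - k1))%:E <= area X)%E.
Proof.
move=> jk kk kj al0 be0 HJ HK.
have jj : j1 < j2 by rewrite (le_lt_trans jk)// (lt_le_trans kk).
pose f (q : measurableTypeR R) : \bar R :=
  (al%:E * (\1_`]j1, j2[ q)%:E + be%:E * (\1_`]k1, k2[ q)%:E)%E.
have -> : (al * (j2 - j1) + be * (k2 - k1))%:E = (\int[mu]_q f q)%E.
  have mI (a b : R) : measurable_fun setT
      (fun q : measurableTypeR R => (\1_`]a, b[ q)%:E : \bar R).
    exact/measurable_EFinP/measurable_indic.
  have I0 (c a b : R) (q : measurableTypeR R) :
      0 <= c -> (0 <= c%:E * (\1_`]a, b[ q)%:E :> \bar R)%E.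
    by move=> c0; rewrite mule_ge0// lee_fin.
  rewrite ge0_integralD//=;
    [|by move=> q _; apply: I0|exact: measurable_funeM
     |by move=> q _; apply: I0|exact: measurable_funeM].
  rewrite !ge0_integralZl//.
  rewrite !integral_indic// !setIT EFinD !EFinM.
  by congr (_ * _ + _ * _)%E; apply/esym/lebesgue_measure_oo.
apply: ge0_le_integral_nomeas => [q|q].
  by rewrite /f adde_ge0// mule_ge0// lee_fin.
rewrite /f !indicE !mem_setE !in_itv/= .
have [qK|_] := boolP (k1 < q < k2).
  have -> : j1 < q < j2.
    by case/andP: qK => kq qk; rewrite (le_lt_trans jk kq) (lt_le_trans qk kj).
  by rewrite !mule1 -EFinD; exact: HK.
rewrite mule0 adde0; have [qJ|_] := boolP (j1 < q < j2); first by rewrite mule1; exact: HJ.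
by rewrite mule0 measure_ge0.
Qed.

End Area.

(** * Images of thin rectangles *)

Section Stretch.
Context {R : realType}.
Implicit Types (U : set (R * R)) (f : R * R -> R * R).

Lemma open_rect (a b c d : R) : open (`]a, b[ `*` `]c, d[ : set (R * R)).
Proof.
rewrite openE => -[q p] [/= Hq Hp]; exists (`]a, b[%classic, `]c, d[%classic) => //=.
by split; apply: open_nbhs_nbhs; split => //; exact: interval_open.
Qed.

Lemma bounded_rect (a b c d : R) : bounded_set (`]a, b[ `*` `]c, d[ : set (R * R)).
Proof.
exists (`|a| + `|b| + `|c| + `|d|); split; first exact: num_real.
move=> M HM [q p] [/= + +]; rewrite !in_itv/= => /andP[aq qb] /andP[cp pd].
have := ler_norm b; have := ler_norm d.
have := ler_norm (- a); have := ler_norm (- c); rewrite !normrN.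
have := normr_ge0 a; have := normr_ge0 b; have := normr_ge0 c; have := normr_ge0 d.
move=> *; rewrite /Num.norm/= ge_max !ler_norml.
by apply/andP; split => /=; apply/andP; split; lra.
Qed.

Lemma nbhs_pair (x y : R) (P : R * R -> Prop) : (\forall z \near (x, y), P z) ->
  exists2 e : R, 0 < e & forall q p, `|q - x| < e -> `|p - y| < e -> P (q, p).
Proof.
move=> /nbhs_ballP[e /= e0 He]; exists e => // q p qx py; apply: He.
by split; rewrite /ball/= distrC.
Qed.

Lemma continuous_line_q U f (p : R) (l h : R) : {in U, continuous f} ->
  (forall q, l <= q <= h -> U (q, p)) ->
  {within `[l, h], continuous (fun q => (f (q, p)).1)} /\
  {within `[l, h], continuous (fun q => (f (q, p)).2)}.
Proof.
move=> cf HU.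
have H q : q \in `[l, h] -> {for q, continuous (fun q => f (q, p))}.
  rewrite in_itv/= => /HU Uq.
  apply: (continuous_comp (f := fun q : R => (q, p)) (g := f)).
    exact: (cvg_pair (f := id) (g := cst p) (F := nbhs q) cvg_id (cvg_cst _)).
  exact/cf/mem_set.
split; apply: continuous_in_subspaceT => q /set_mem qlh.
- apply: (continuous_comp (g := fst)); [exact: H|exact: cvg_fst].
- apply: (continuous_comp (g := snd)); [exact: H|exact: cvg_snd].
Qed.

(** The points are where g = (f (., 1)).1 attains its maximum and minimum on [-d, d]. If these
    extrema differed by less than 2 d, a thin rectangle over ]-d, d[ would be mapped into a narrower
    one of equal height, contradicting area conservation. *)
Lemma free_stretch U f :
  open U -> U (0, 1) -> {in U, continuous f} -> conserves_volume U f ->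
  (forall z, U z -> (f z).2 ^+ 2 = z.2 ^+ 2) ->
  0 < (f (0, 1)).1 -> 0 < (f (0, 1)).2 ->
  exists l h d : R, [/\ l < h /\ 0 < d,
    forall q p, l <= q <= h -> 1 - d < p < 1 + d -> U (q, p),
    (f (l, 1)).2 = 1 /\ (f (h, 1)).2 = 1,
    h < (f (l, 1)).1 /\ h < (f (h, 1)).1 &
    h - l <= `|(f (l, 1)).1 - (f (h, 1)).1| ].
Proof.
move=> oU U01 cf vf ef; set c := (f (0, 1)).1 => c0 f20.
have cf0 : {for (0, 1), continuous f} by exact/cf/mem_set.
have /nbhs_pair[e e0 He] : \forall z \near ((0, 1) : R * R),
    [/\ U z, c / 2 < (f z).1 & 0 < (f z).2].
  near=> z; split; near: z.
  - exact: open_nbhs_nbhs.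
  - have : (f z).1 @[z --> (0, 1) : R * R] --> c.
      by apply: (continuous_comp (g := fst)); [exact: cf0|exact: cvg_fst].
    by move=> /cvgr_gt; apply; rewrite ltr_pdivrMr// mulr_natr mulr2n ltrDl.
  - have : (f z).2 @[z --> (0, 1) : R * R] --> (f (0, 1)).2.
      by apply: (continuous_comp (g := snd)); [exact: cf0|exact: cvg_snd].
    by move=> /cvgr_gt; apply.
(* [d < e] keeps the rectangle in U; [d < c / 2] puts the images of all points over [-d, d] to the
   right of d. *)
have [d [d0 de dc]] : exists d : R, [/\ 0 < d, d < e & d < c / 2].
  exists (Num.min e (c / 2) / 2).
  have m0 : 0 < Num.min e (c / 2) by rewrite lt_min e0 divr_gt0.
  have h1 : Num.min e (c / 2) <= e by rewrite ge_min lexx.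
  have h2 : Num.min e (c / 2) <= c / 2 by rewrite ge_min lexx orbT.
  by split; lra.
have Hbox q p : - d <= q <= d -> `|p - 1| < e ->
    [/\ U (q, p), c / 2 < (f (q, p)).1 & 0 < (f (q, p)).2].
  move=> qd pe; apply: He => //; rewrite subr0 ltr_norml; lra.
pose g q := (f (q, 1)).1.
have Hbox1 q : - d <= q <= d -> [/\ U (q, 1), c / 2 < g q & 0 < (f (q, 1)).2].
  by move=> qd; apply: Hbox => //; rewrite subrr normr0.
have cg : {within `[- d, d], continuous g}.
  by apply: (continuous_line_q _ _ 1 _ _ cf _).1 => q /Hbox1[].
have dd : - d <= d by lra.
have [x xd Hx] := EVT_max dd cg.
have [y yd Hy] := EVT_min dd cg.
have [xd' yd'] : - d <= x <= d /\ - d <= y <= d.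
  by move: xd yd; rewrite !in_itv.
have Mm : 2 * d <= g x - g y.
  rewrite leNgt; apply/negP => lt2d.
  (* Widening by eta at both ends uses up half of the deficit, so the width stays below 2 d. *)
  pose eta := (2 * d - (g x - g y)) / 4.
  have eta0 : 0 < eta by rewrite /eta; lra.
  (* Compactness of [-d, d] makes the bounds known at p = 1 hold uniformly for p near 1. *)
  have : \forall p \near (1 : R), `[- d, d]%classic `<=`
      [set q | g y - eta < (f (q, p)).1 < g x + eta].
    have /compact_near_coveringP/(_ R (nbhs (1 : R))
      (fun p q => g y - eta < (f (q, p)).1 < g x + eta)) := @segment_compact R (- d) d.
    apply => q /=; rewrite in_itv/= => qd.
    have [Uq _ _] := Hbox1 _ qd.
    have cfq : {for (q, 1), continuous f} by exact/cf/mem_set.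
    have cf1 : (f z).1 @[z --> (q, 1) : R * R] --> g q.
      by apply: (continuous_comp (g := fst)); [exact: cfq|exact: cvg_fst].
    have q_in : q \in `[- d, d] by rewrite in_itv.
    have gl : g y - eta < g q by have := Hy _ q_in; lra.
    have gr : g q < g x + eta by have := Hx _ q_in; lra.
    have near1 := cvgr_gt _ cf1 _ gl; have near2 := cvgr_lt _ cf1 _ gr.
    have nearz : \forall z \near ((q, 1) : R * R),
        g y - eta < (f (z.1, z.2)).1 < g x + eta.
      near=> z; rewrite -surjective_pairing; apply/andP; split; near: z.
        exact: near1.
      exact: near2.
    exact: nearz.
  move=> /nbhs_ballP[e1 /= e10 He1].
  pose ep := Num.min e1 (Num.min e 1).
  have ep0 : 0 < ep by rewrite !lt_min e0 e10 ltr01.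
  have epe : ep <= e by rewrite !ge_min lexx orbT.
  have ep1 : ep <= 1 by rewrite !ge_min lexx !orbT.
  have epe1 : ep <= e1 by rewrite ge_min lexx.
  pose A : set (R * R) := `]- d, d[ `*` `]1 - ep, 1 + ep[.
  have AU : A `<=` U.
    move=> [q p] [/=]; rewrite !in_itv/= => qd pe.
    by have [] : [/\ U (q, p), c / 2 < (f (q, p)).1 & 0 < (f (q, p)).2];
      [apply: Hbox; rewrite ?ltr_norml; lra|].
  have /(le_area (f @` A)) : f @` A `<=`
      `]g y - eta, g x + eta[ `*` `]1 - ep, 1 + ep[.
    move=> _ [[q p] [/= + +] <-]; rewrite !in_itv/= => qd pe.
    have [Uz _ fp] : [/\ U (q, p), c / 2 < (f (q, p)).1 & 0 < (f (q, p)).2].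
      by apply: Hbox; rewrite ?ltr_norml; lra.
    split => /=.
      apply: (He1 p); last by rewrite /= in_itv/=; lra.
      by rewrite /ball/= distrC ltr_norml; lra.
    suff -> : (f (q, p)).2 = p by [].
    have := ef _ Uz => /= /eqP; rewrite eqf_sqr => /orP[/eqP //|/eqP fpE].
    by move: fp; rewrite fpE; move: pe; lra.
  have gyx := Hy _ xd.
  rewrite vf//; [|exact: open_rect|exact: bounded_rect].
  rewrite !area_rect ?lee_fin; [|lra..].
  rewrite leNgt => /negP; apply.
  rewrite (_ : 1 + ep - (1 - ep) = 2 * ep); last by ring.
  by rewrite ltr_pM2r ?mulr_gt0//; rewrite /eta; lra.
exists (Num.min x y), (Num.max x y), d.
have [xx0 xx1 xx2] := Hbox1 _ xd'.
have [yy0 yy1 yy2] := Hbox1 _ yd'.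
have f21 q : - d <= q <= d -> (f (q, 1)).2 = 1.
  move=> /Hbox1[Uq _ fq]; have := ef _ Uq => /= /eqP; rewrite eqf_sqr => /orP[/eqP //|/eqP fE].
  by move: fq; rewrite fE; lra.
case: (ltgtP x y) Mm => [xy|xy|->]; last lra.
- move=> Mm; split => //.
  + by move=> q p qxy p1; have [] := Hbox q p; [lra|rewrite ltr_norml; lra|].
  + by split; apply: f21.
  + split; [rewrite -/(g x); lra|rewrite -/(g y); lra].
  + by rewrite -/(g x) -/(g y); apply: le_trans (ler_norm _); lra.
- move=> Mm; split => //.
  + by move=> q p qxy p1; have [] := Hbox q p; [lra|rewrite ltr_norml; lra|].
  + by split; apply: f21.
  + split; [rewrite -/(g y); lra|rewrite -/(g x); lra].
  + by rewrite -/(g x) -/(g y) distrC; apply: le_trans (ler_norm _); lra.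
Unshelve. all: by end_near. Qed.

End Stretch.

(** * Excess area of the image above a potential bump *)

Section Strip.
Context {R : realType}.
Implicit Types (U : set (R * R)) (f : R * R -> R * R) (V : R -> R).

(* Thickness of the strip (1 - ep)^2 < p^2 + 2 w < (1 + ep)^2: the case v = 0
   gives 2 ep for every w, the other one gives the gain where w >= v > 0. *)
Lemma sqrt_gap (ep w v : R) : 0 < ep -> ep <= 8^-1 -> ep <= v \/ v = 0 ->
  0 <= v -> v <= w -> w <= 8^-1 ->
  2 * ep + ep * v <=
    Num.sqrt ((1 + ep) ^+ 2 - 2 * w) - Num.sqrt ((1 - ep) ^+ 2 - 2 * w).
Proof.
move=> ep0 ep8 epv v0 vw w8.
have a0 : 0 < (1 - ep) ^+ 2 - 2 * w by nra.
have b0 : 0 < (1 + ep) ^+ 2 - 2 * w by nra.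
have := sqr_sqrtr (ltW a0); have := sqr_sqrtr (ltW b0).
have := sqrtr_gt0 ((1 - ep) ^+ 2 - 2 * w); rewrite a0.
have := sqrtr_gt0 ((1 + ep) ^+ 2 - 2 * w); rewrite b0.
set s := Num.sqrt _; set t := Num.sqrt _ => s0 t0 s2 t2.
have st : (s - t) * (s + t) = 4 * ep by rewrite -subr_sqr s2 t2; ring.
(* This suffices, since (s - t)(s + t) = 4 ep and (2 + v)(2 - v) <= 4. For ep <= v it comes from (s
   + t)^2 <= 2 (s^2 + t^2), for v = 0 from bounding s and t separately. *)
have sum_le : s + t <= 2 - v.
  case: epv => [epv|v0']; last first.
    have s_le : s <= 1 + ep by rewrite -ler_sqr ?nnegrE; lra.
    have t_le : t <= 1 - ep by rewrite -ler_sqr ?nnegrE; lra.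
    lra.
  rewrite -ler_sqr ?nnegrE; [|lra|lra].
  have h : (s + t) ^+ 2 <= 2 * (s ^+ 2 + t ^+ 2).
    by rewrite -subr_ge0 (_ : _ - _ = (s - t) ^+ 2) ?sqr_ge0//; ring.
  by apply: le_trans h _; rewrite s2 t2; nra.
have st0 : 0 < s + t by lra.
have h : ep * (2 + v) * (s + t) <= ep * (2 + v) * (2 - v).
  by rewrite ler_wpM2l// mulr_ge0; lra.
have vv : 0 <= ep * v ^+ 2 by rewrite mulr_ge0 ?sqr_ge0// ltW.
rewrite -(ler_pM2r st0) st; lra.
Qed.

(** A rectangle of height 2 ep over ]l, h[ has area 2 ep (h - l). Above nearly all of the interval
    between the two end images, its image covers the strip of the same energies with positive
    momentum, which is at least 2 ep thick, and thicker by ep v0 above ]k1, k2[. *)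
Lemma slowed_image_not_conserves_volume U f V (l h d k1 k2 v0 : R) :
  l < h -> 0 < d ->
  (forall q p, l <= q <= h -> 1 - d < p < 1 + d -> U (q, p)) ->
  {in U, continuous f} ->
  (forall z, U z -> natural_hamiltonian V (f z) = natural_hamiltonian V z) ->
  (forall q, 0 <= V q <= 8^-1) -> (forall q, l <= q <= h -> V q = 0) ->
  0 < (f (l, 1)).2 ->
  h - l <= `|(f (l, 1)).1 - (f (h, 1)).1| ->
  Num.min (f (l, 1)).1 (f (h, 1)).1 < k1 -> k1 < k2 ->
  k2 < Num.max (f (l, 1)).1 (f (h, 1)).1 ->
  0 < v0 -> (forall q, k1 < q < k2 -> v0 <= V q) ->
  ~ conserves_volume U f.
Proof.
set a := (f (l, 1)).1; set b := (f (h, 1)).1.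
move=> lh d0 HU cf ef V08 V0 fl0 hl lo_k kk k_hi v00 Vk vf.
set lo := Num.min a b in lo_k *; set hi := Num.max a b in k_hi *.
have hlE : h - l <= hi - lo.
  apply: le_trans hl _; rewrite /hi /lo.
  by case: (leP a b) => ab; [rewrite ler0_norm|rewrite gtr0_norm]; lra.
(* The end images are controlled only up to [ka], which costs 2 ka of width and 4 ep ka of area; the
   last bound keeps this below the gain ep v0 (k2 - k1). *)
have [ka [ka0 ka1 ka2 ka3]] : exists ka : R,
    [/\ 0 < ka, ka < k1 - lo, ka < hi - k2 & 4 * ka < v0 * (k2 - k1)].
  pose m := Num.min (k1 - lo) (Num.min (hi - k2) (v0 * (k2 - k1) / 4)).
  have m0 : 0 < m by rewrite !lt_min !subr_gt0 lo_k k_hi divr_gt0// mulr_gt0// subr_gt0.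
  have h1 : m <= k1 - lo by rewrite ge_min lexx.
  have h2 : m <= hi - k2 by rewrite !ge_min lexx orbT.
  have h3 : m <= v0 * (k2 - k1) / 4 by rewrite !ge_min lexx !orbT.
  by exists (m / 2); split; lra.
have [e e0 He] : exists2 e : R, 0 < e & forall p, `|p - 1| < e ->
    [/\ `|(f (l, p)).1 - a| < ka, `|(f (h, p)).1 - b| < ka & 0 < (f (l, p)).2].
  have U1 q : l <= q <= h -> U (q, 1) by move=> qlh; apply: HU => //; lra.
  have ll : l <= l <= h by lra.
  have hh : l <= h <= h by lra.
  have cl : {for (l, 1), continuous f} by exact/cf/mem_set/U1.
  have ch : {for (h, 1), continuous f} by exact/cf/mem_set/U1.
  have n1 : \forall z \near ((l, 1) : R * R), `|a - (f z).1| < ka.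
    have : (f z).1 @[z --> (l, 1) : R * R] --> a.
      by apply: (continuous_comp (g := fst)); [exact: cl|exact: cvg_fst].
    by move=> /cvgr_dist_lt; apply.
  have n2 : \forall z \near ((h, 1) : R * R), `|b - (f z).1| < ka.
    have : (f z).1 @[z --> (h, 1) : R * R] --> b.
      by apply: (continuous_comp (g := fst)); [exact: ch|exact: cvg_fst].
    by move=> /cvgr_dist_lt; apply.
  have n3 : \forall z \near ((l, 1) : R * R), 0 < (f z).2.
    have : (f z).2 @[z --> (l, 1) : R * R] --> (f (l, 1)).2.
      by apply: (continuous_comp (g := snd)); [exact: cl|exact: cvg_snd].
    by move=> /cvgr_gt; apply.
  have [e1 e10 H1] := nbhs_pair _ _ _ n1.
  have [e2 e20 H2] := nbhs_pair _ _ _ n2.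
  have [e3 e30 H3] := nbhs_pair _ _ _ n3.
  exists (Num.min e1 (Num.min e2 e3)); first by rewrite !lt_min e10 e20 e30.
  move=> p; rewrite !lt_min => /and3P[pe1 pe2 pe3].
  split; [rewrite distrC; apply: H1|rewrite distrC; apply: H2|apply: H3] => //.
  - by rewrite subrr normr0.
  - by rewrite subrr normr0.
  - by rewrite subrr normr0.
(* [e] controls the end images, [d] keeps the rectangle in U, and 1/8 and [v0] are the bounds
   required by [sqrt_gap]. *)
pose ep := Num.min (Num.min e d) (Num.min 8^-1 v0).
have ep0 : 0 < ep by rewrite !lt_min e0 d0 v00 invr_gt0 ltr0n.
have epe : ep <= e by rewrite !ge_min lexx.
have epd : ep <= d by rewrite !ge_min lexx !orbT.
have ep8 : ep <= 8^-1 by rewrite !ge_min lexx !orbT.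
have epv : ep <= v0 by rewrite !ge_min lexx !orbT.
have energy q p : l <= q <= h -> 1 - ep < p < 1 + ep ->
    (f (q, p)).2 ^+ 2 + 2 * V (f (q, p)).1 = p ^+ 2.
  move=> qlh pep; have Uqp : U (q, p) by apply: HU => //; lra.
  by have := ef _ Uqp; rewrite /natural_hamiltonian /= (V0 _ qlh); lra.
(* A sign change along the segment would pass through momentum 0, where energy forces p^2 = 2 V <=
   1/4, although p > 7/8. *)
have fpos q p : l <= q <= h -> 1 - ep < p < 1 + ep -> 0 < (f (q, p)).2.
  move=> qlh pep; rewrite ltNge; apply/negP => fneg.
  have [_ _ flp] : [/\ `|(f (l, p)).1 - a| < ka,
      `|(f (h, p)).1 - b| < ka & 0 < (f (l, p)).2].
    by apply: He; rewrite ltr_norml; lra.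
  have lq : l <= q by lra.
  have cu : {within `[l, q], continuous (fun x => (f (x, p)).2)}.
    by apply: (continuous_line_q _ _ p l q cf _).2 => x xlq; apply: HU; lra.
  have [|x] := @IVT R _ l q 0 lq cu.
    by rewrite ge_min le_max fneg (ltW flp) orbT.
  rewrite in_itv/= => xlq fx0.
  have := energy x p; rewrite fx0 expr0n/=.
  have := V08 (f (x, p)).1.
  nra.
pose A : set (R * R) := `]l, h[ `*` `]1 - ep, 1 + ep[.
have AU : A `<=` U.
  by move=> [q p] [/=]; rewrite !in_itv/= => qlh pep; apply: HU; lra.
have fA q P : lo + ka < q < hi - ka -> 0 < P ->
    (1 - ep) ^+ 2 < P ^+ 2 + 2 * V q < (1 + ep) ^+ 2 -> (f @` A) (q, P).
  move=> qJ P0 PV.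
  (* V vanishes above [l, h], so energy conservation dictates the height p at which a preimage of
     (q, P) must lie; the intermediate value theorem then finds its abscissa. *)
  pose p := Num.sqrt (P ^+ 2 + 2 * V q).
  have p0 : 0 <= p by exact: sqrtr_ge0.
  have p2 : p ^+ 2 = P ^+ 2 + 2 * V q by rewrite sqr_sqrtr//; nra.
  have pep : 1 - ep < p < 1 + ep.
    have ep1 : 0 <= 1 - ep /\ 0 <= 1 + ep by split; lra.
    clear -p0 p2 PV ep1; case: ep1 => ? ?.
    by apply/andP; split; rewrite -ltr_sqr ?nnegrE ?p2; lra.
  have [fl fh _] : [/\ `|(f (l, p)).1 - a| < ka,
      `|(f (h, p)).1 - b| < ka & 0 < (f (l, p)).2].
    by apply: He; rewrite ltr_norml; lra.
  have cu : {within `[l, h], continuous (fun x => (f (x, p)).1)}.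
    by apply: (continuous_line_q _ _ p l h cf _).1 => x xlh; apply: HU; lra.
  have [|x] := @IVT R _ l h q (ltW lh) cu.
    rewrite ge_min le_max; clear -qJ fl fh; move: qJ fl fh; rewrite /lo /hi !ltr_norml.
    by case: (leP a b) => ab *; apply/andP; split; apply/orP; [left|right|right|left]; lra.
  rewrite in_itv/= => xlh fxq.
  (* The rectangle is open, so the end points must be excluded: their images lie within [ka] of [a]
     and [b], out of reach of q. *)
  have xl : x != l.
    apply/eqP => xl; move: fxq fl qJ; rewrite xl => ->; rewrite /lo /hi ltr_norml; clear.
    by case: (leP a b) => ab; lra.
  have xh : x != h.
    apply/eqP => xh; move: fxq fh qJ; rewrite xh => ->; rewrite /lo /hi ltr_norml; clear.
    by case: (leP a b) => ab; lra.
  exists (x, p).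
    split; rewrite /= in_itv/=; last lra.
    by rewrite !lt_neqAle xh eq_sym xl.
  have fx0 := fpos x p xlh pep.
  have := energy x p xlh pep; rewrite fxq p2 => /addIr/eqP.
  rewrite eqf_sqr => /orP[/eqP fP|/eqP fP]; last by exfalso; lra.
  by rewrite [f _]surjective_pairing fxq fP.
have strip q v : lo + ka < q < hi - ka -> ep <= v \/ v = 0 -> 0 <= v -> v <= V q ->
    ((2 * ep + ep * v)%:E <= lebesgue_measure (xsection (f @` A) q))%E.
  move=> qJ epv' v0' vV.
  have /andP[Vq0 Vq8] := V08 q.
  have gap := sqrt_gap _ _ _ ep0 ep8 epv' v0' vV Vq8.
  set s := Num.sqrt ((1 + ep) ^+ 2 - 2 * V q) in gap.
  set t := Num.sqrt ((1 - ep) ^+ 2 - 2 * V q) in gap.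
  have t0 : 0 <= t by exact: sqrtr_ge0.
  have s0 : 0 <= s by exact: sqrtr_ge0.
  have t2 : t ^+ 2 = (1 - ep) ^+ 2 - 2 * V q by rewrite sqr_sqrtr//; nra.
  have s2 : s ^+ 2 = (1 + ep) ^+ 2 - 2 * V q by rewrite sqr_sqrtr//; nra.
  have ts : t < s by nra.
  apply: (@le_trans _ _ (lebesgue_measure `]t, s[)).
    by rewrite lebesgue_measure_oo// lee_fin.
  apply: le_lebesgue_measure_nomeas => P /=; rewrite in_itv/= => tPs.
  rewrite /xsection/= inE; apply: fA => //; first by lra.
  by apply/andP; split; nra.
have := area_ge (f @` A) (lo + ka) (hi - ka) k1 k2 (2 * ep) (ep * v0).
rewrite vf//; [|exact: open_rect|exact: bounded_rect].
rewrite area_rect; [|lra|lra].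
rewrite lee_fin => H.
have : 2 * ep * (hi - ka - (lo + ka)) + ep * v0 * (k2 - k1) <= (h - l) * (1 + ep - (1 - ep)).
  have epv0 : 0 <= ep * v0 by rewrite mulr_ge0// ltW.
  apply: H => //; [lra|lra|lra| |].
  - move=> q qJ; have := strip q 0 qJ; rewrite mulr0 addr0; apply => //; first by right.
    by case/andP: (V08 q).
  - move=> q qK; apply: strip => //; [lra|by left|lra|exact: Vk].
apply/negP; rewrite -ltNge.
have : ep * (4 * ka) < ep * (v0 * (k2 - k1)) by rewrite ltr_pM2l.
nra.
Qed.

End Strip.

(** * The theorem *)

Section Final.
Context {R : realType}.

(** By induction on the list: to avoid one more point, keep the last quarter of the interval if the
    point is in the left half, and the first quarter otherwise. *)
Lemma itv_avoiding (s : seq R) (a b : R) : a < b ->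
  exists k1 k2, [/\ a < k1, k1 < k2, k2 < b & forall x, x \in s -> ~~ (k1 <= x <= k2)].
Proof.
elim: s => [|x s IH] ab.
  by exists ((2 * a + b) / 3), ((a + 2 * b) / 3); split=> //; lra.
have [k1 [k2 [ak kk kb Hs]]] := IH ab.
have [xm|mx] := leP x ((k1 + k2) / 2).
- exists ((k1 + 3 * k2) / 4), k2; split; [lra..|].
  move=> y; rewrite inE => /predU1P[->|/Hs]; first by apply/negP; lra.
  by apply: contra; lra.
- exists k1, ((3 * k1 + k2) / 4); split; [lra..|].
  move=> y; rewrite inE => /predU1P[->|/Hs]; first by apply/negP; lra.
  by apply: contra; lra.
Qed.

(** [S] is merely some flow, so it has to be identified: p and q - t p have zero derivative along
    it. *)
Lemma free_flow (S : R -> R * R -> R * R) (t : R) (z : R * R) :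
  is_flow (@free_hamiltonian R) S -> S t z = (z.1 + t * z.2, z.2).
Proof.
move=> /(_ z)[S0 HS].
have freeE : @free_hamiltonian R = separable 2^-1 0 (cst 0).
  by apply/funext => w; rewrite /free_hamiltonian /separable /=; lra.
have pq w : partial_q (@free_hamiltonian R) w = 0.
  have := separable_q 2^-1 0 (cst 0) w (smooth1_cst 0); rewrite -freeE => h.
  by rewrite /partial_q derive_val /separable derive1E derive_cst; lra.
have pp w : partial_p (@free_hamiltonian R) w = w.2.
  have := separable_p 2^-1 0 (cst 0) w; rewrite -freeE => h.
  by rewrite /partial_p derive_val /separable /=; lra.
have S2 s : (S s z).2 = z.2.
  rewrite -[in RHS]S0; apply: (is_derive_0_is_cst (f := fun s => (S s z).2)) => x.
  by have [_] := HS x; rewrite pq oppr0.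
have S1 : (S t z).1 - t * z.2 = (S 0 z).1 - 0 * z.2.
  apply: (is_derive_0_is_cst (f := fun s => (S s z).1 - s * z.2)) => x.
  have [+ _] := HS x; rewrite pp S2 => dS1.
  have dl : is_derive x 1 (fun s => s * z.2) z.2.
    by have := is_deriveM (is_derive_id x (1 : R)) (is_derive_cst z.2 x 1);
      rewrite scaler0 add0r [_ *: _]mulr1.
  by have := is_deriveB dS1 dl; rewrite subrr.
rewrite [S t z]surjective_pairing S2; congr pair.
by move: S1; rewrite S0 mul0r subr0 => /eqP; rewrite subr_eq => /eqP.
Qed.

(** The list consists of the abscissas at which the integrator samples the free Hamiltonian. It is
    fixed before V, so a bump can be placed afterwards away from it; near the sampled points both
    Hamiltonians then coincide, with all their derivatives. *)
Lemma reasonable_agree_off_points (Phi : integrator R) (dt : R) (z : R * R) :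
  computationally_reasonable Phi -> 0 <= dt ->
  exists s : seq R, forall (V : R -> R) (k1 k2 : R), smooth1 V ->
    (forall x, x \in s -> ~~ (k1 <= x <= k2)) ->
    (forall x, ~~ (k1 < x < k2) -> V x = 0) ->
    Phi (natural_hamiltonian V) z dt = Phi (@free_hamiltonian R) z dt.
Proof.
move=> /(_ (@free_hamiltonian R) z dt free_smooth2) /[apply] -[m [r [a Hra]]].
exists [seq (r j).1 | j <- enum 'I_m] => V k1 k2 sV Hs V0.
apply/esym/Hra; first exact: natural_smooth2.
move=> j; apply: (@partial_local _ (~` `[k1, k2])).
- by rewrite openC; exact: interval_closed.
- move=> w /= /negP; rewrite in_itv/= => nw.
  rewrite /natural_hamiltonian V0 ?addr0//.
  by apply: contra nw => /andP[? ?]; rewrite !ltW.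
- by move=> /=; rewrite in_itv/=; apply/negP/Hs/map_f; rewrite mem_enum.
Qed.

End Final.

Theorem theorem1 (R : realType) (Phi : integrator R) (U : set (R * R))
    (S : R -> R * R -> R * R) :
  open U -> (forall q : R, U (q, 1)) ->
  is_flow (@free_hamiltonian R) S ->
  consistent_at Phi (@free_hamiltonian R) S (0, 1) ->
  computationally_reasonable Phi ->
  conserves_energy Phi ->
  (exists2 dt0 : R, 0 < dt0 & forall dt : R, 0 <= dt -> dt <= dt0 ->
     continuous_conservative_on U (fun z => Phi (@free_hamiltonian R) z dt)) ->
  \forall dt \near (0 : R)^'+, exists V : R -> R,
    [/\ smooth_compact_support V,
        ~ continuous_conservative_on U
            (fun z => Phi (natural_hamiltonian V) z dt)
      & forall lambda : R, 0 < lambda -> lambda < 1 ->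
          ~ continuous_conservative_on U
              (fun z => Phi (natural_hamiltonian (fun x => lambda * V x)) z dt)].
Proof.
move=> oU HU flS [F [FPhi cF]] comp ener [dt0 dt00 cons].
(* Since S dt (0, 1) = (dt, 1), an error below dt / 2 makes the first coordinate exceed dt / 2 and,
   as dt < 1, the second exceed 1/2. *)
have nF : \forall dt \near (0 : R)^'+, `| `|S dt (0, 1) - F dt| / dt | < 2^-1.
  by move/cvgr0_norm_lt : cF; apply; rewrite invr_gt0.
near=> dt.
have dt_gt0 : 0 < dt by near: dt; exact: nbhs_right_gt.
have dt_le : dt <= dt0 by near: dt; exact: nbhs_right_le.
have PhiF : Phi (@free_hamiltonian R) (0, 1) dt = Some (F dt) by near: dt.
have dt_lt1 : dt < 1 by near: dt; exact: nbhs_right_lt.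
have Fdt : `| `|S dt (0, 1) - F dt| / dt | < 2^-1 by near: dt.
have [f [Pf wcf vf]] := cons dt (ltW dt_gt0) dt_le.
have cf : {in U, continuous f} by rewrite -continuous_open_subspace.
have f0 : f (0, 1) = F dt by have := Pf _ (HU 0); rewrite PhiF => -[].
have {Fdt} : `|S dt (0, 1) - F dt| < dt / 2.
  by move: Fdt; rewrite normrM normr_id normfV (gtr0_norm dt_gt0) ltr_pdivrMr// mulrC.
rewrite (free_flow _ _ _ flS) /= add0r mulr1 -f0 /Num.norm/= gt_max => /andP[f1 f2].
have f10 : 0 < (f (0, 1)).1.
  by have : `|dt - (f (0, 1)).1| < dt / 2 := f1; rewrite ltr_norml; lra.
have f20 : 0 < (f (0, 1)).2.
  by have : `|1 - (f (0, 1)).2| < dt / 2 := f2; rewrite ltr_norml; lra.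
have ef z : U z -> (f z).2 ^+ 2 = z.2 ^+ 2.
  move=> /Pf /(ener _ _ _ _ free_smooth2 (ltW dt_gt0)).
  by rewrite /free_hamiltonian; lra.
have [l [h [d [[lh d0] HUd [fl2 fh2] [hl1 hh1] stretch]]]] :=
  free_stretch U f oU (HU 0) cf vf ef f10 f20.
have [s1 Hs1] := reasonable_agree_off_points Phi dt (l, 1) comp (ltW dt_gt0).
have [s2 Hs2] := reasonable_agree_off_points Phi dt (h, 1) comp (ltW dt_gt0).
have minmax : Num.min (f (l, 1)).1 (f (h, 1)).1 < Num.max (f (l, 1)).1 (f (h, 1)).1.
  move: stretch; case: (ltgtP (f (l, 1)).1 (f (h, 1)).1) => // ->.
  by rewrite subrr normr0; lra.
(* One interval avoids the sampled abscissas of both evaluations, at (l, 1) and at (h, 1). *)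
have [k1 [k2 [lok kk khi Hk]]] := itv_avoiding (s1 ++ s2) _ _ minmax.
have hk1 : h < k1.
  by apply: lt_trans lok; rewrite lt_min hl1 hh1.
(* [k1] and [k2] do not depend on the amplitude [s], so this claim serves V, with s = 1/8, and every
   lambda V, with s = lambda / 8. *)
have main (s : R) : 0 < s -> s <= 8^-1 -> ~ continuous_conservative_on U
    (fun z => Phi (natural_hamiltonian (flat_bump s k1 k2)) z dt).
  move=> s0 s8 [g [Pg wcg vg]].
  have cg : {in U, continuous g} by rewrite -continuous_open_subspace.
  have sV := flat_bump_smooth1 s k1 k2.
  have Vout x : ~~ (k1 < x < k2) -> flat_bump s k1 k2 x = 0 by exact: flat_bump_out.
  have gl : g (l, 1) = f (l, 1).
    have := Pg _ (HU l); rewrite (Hs1 _ k1 k2)// ?Pf// => [[]//|x xs].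
    by apply: Hk; rewrite mem_cat xs.
  have gh : g (h, 1) = f (h, 1).
    have := Pg _ (HU h); rewrite (Hs2 _ k1 k2)// ?Pf// => [[]//|x xs].
    by apply: Hk; rewrite mem_cat xs orbT.
  (* The bump tends to 0 at the ends of its support, so a positive lower bound is taken on the
     middle third. *)
  pose j1 := (2 * k1 + k2) / 3; pose j2 := (k1 + 2 * k2) / 3.
  have [kj1 jj j2k] : [/\ k1 < j1, j1 < j2 & j2 < k2] by rewrite /j1 /j2; split; lra.
  have [v0 v00 Hv0] := flat_bump_lower_bound s k1 k2 j1 j2 s0 kj1 j2k.
  apply: (slowed_image_not_conserves_volume U g (flat_bump s k1 k2)
    l h d j1 j2 v0 lh d0 HUd cg) => //.
  - by move=> z Uz; exact: (ener _ _ _ _ (natural_smooth2 _ sV) (ltW dt_gt0) (Pg _ Uz)).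
  - by move=> q; rewrite flat_bump_ge0 ?(ltW s0)//= (le_trans _ s8)// flat_bump_le// ltW.
  - by move=> q /andP[_ qh]; apply: Vout; apply/negP; lra.
  - by rewrite gl fl2.
  - by rewrite gl gh.
  - by rewrite gl gh; lra.
  - by rewrite gl gh; lra.
exists (flat_bump 8^-1 k1 k2); split.
- exact: flat_bump_smooth_compact_support.
- by apply: main; rewrite ?invr_gt0.
- move=> la la0 la1; rewrite flat_bumpZ; apply: main; first by rewrite mulr_gt0.
  by rewrite ger_pMl// ltW.
Unshelve. all: by end_near. Qed.
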